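(* Let $R$ be a commutative ring, $(G,L)$ a finite $R^\times$-network (with edge weights $w$ and diagonal terms $d$), $S\subseteq V^\circ(G)$, and suppose $G'=G_{S\to\partial}$ is layerable. Put $s=|S|$ and $m=|S|+|\partial V(G)|$. Then there exists a matrix $A$ over $R$ with $m$ rows and $s$ columns such that for every $R$-module $M$ \[ \mathcal{U}_0(G,L,M)\cong\ker\left(A:M^{s}\to M^{m}\right). \] Moreover $A$ can be computed explicitly from a layerable filtration of $G'$, as follows. Let $G_0\subseteq G_1\subseteq\dots\subseteq G_n=G'$ be a standard form layerable filtration of $G'$. For $0\le j\le n$ let $H_j$ be the $\partial$-graph with \[ V(H_j)=V(G')\setminus V^\circ(G_j),\quad E(H_j)=E(G')\setminus E(G_j),\quad V^\circ(H_j)=V(G')\setminus V(G_j),\quad \partial V(H_j)=\partial V(G_j), \] so that $H_n\subseteq H_{n-1}\subseteq\dots\subseteq H_0$ is a standard form layerable filtration of $H_0$. Choose a consistent labelling $\ell_j:\{1,\dots,m\}\to\partial V(H_j)$ $(0\le j\le n)$ with $\ell_n(\{1,\dots,s\})=S$. Let $T_n=\begin{pmatrix} I & 0 \\ D & I \end{pmatrix}$ with $D=\operatorname{diag}(d(\ell_n(1)),\dots,d(\ell_n(m)))$, and for $0\le j<n$ let $T_j$ be the boundary data transformation for the operation $H_{j+1}\mapsto H_j$. Then one may take \[ A=\begin{pmatrix}0_{m\times m}&I_{m\times m}\end{pmatrix}T_0T_1\cdots T_n\begin{pmatrix} I_{s\times s} \\ 0_{(2m-s)\times s}\end{pmatrix}.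 \]
   Context: Graphs are undirected multigraphs with vertex set $V$ and set $E$ of oriented edges (each undirected edge gives $e$ and its reverse $\overline{e}$); $e_+$, $e_-$ are the starting and ending vertices of $e$; $\mathcal{E}(x)=\{e: e_+=x\}$. A $\partial$-graph is a graph with a partition $V=V^\circ\sqcup\partial V$ (interior and boundary vertices). A generalized Laplacian over $R$ is given by $w:E\to R$ with $w(\overline{e})=w(e)$ and $d:V\to R$, acting on $u:V\to M$ by $Lu(x)=d(x)u(x)+\sum_{e\in\mathcal{E}(x)}w(e)(u(x)-u(e_-))$. An $R^\times$-network $(G,L)$ is a $\partial$-graph with a generalized Laplacian with all $w(e)\in R^\times$. For finite $G$, $\mathcal{U}_0(G,L,M)=\{u\in M^V: Lu\equiv0\text{ on }V,\ u|_{\partial V}\equiv0\}$. For $S\subseteq V^\circ(G)$, $G_{S\to\partial}$ is the $\partial$-graph with the same vertices and edges as $G$ and $\partial V(G_{S\to\partial})=\partial V(G)\sqcup S$. Simple layerable extensions: $G'$ is obtained from $G$ by (i) adjoining an isolated boundary vertex $x$ if $V(G')=V(G)\sqcup\{x\}$, $E(G')=E(G)$, $V^\circ(G')=V^\circ(G)$, and $x$ is a boundary vertex of $G'$ with no incident edges; (ii) adjoining a boundary spike $e$ if $V(G')=V(G)\sqcup\{e_+\}$, $E(G')=E(G)\sqcup\{e,\overline{e}\}$, $V^\circ(G')=V^\circ(G)\sqcup\{e_-\}$, where in $G'$ the vertex $e_-$ is interior and $e_+$ is a boundary vertex with no other incident edges (so $e_-\in\partial V(G)$); (iii) adjoining a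 boundary edge $e$ if $V(G')=V(G)$, $V^\circ(G')=V^\circ(G)$, $E(G')=E(G)\sqcup\{e,\overline{e}\}$ and both endpoints of $e$ are boundary vertices. A finite $\partial$-graph is layerable if it is obtained from $\varnothing$ by finitely many such operations. A standard form layerable filtration of $G'$ is a sequence $G_0\subseteq\dots\subseteq G_n=G'$ in which $G_0$ consists only of isolated boundary vertices and each $G_{j+1}$ is obtained from $G_j$ by adjoining a boundary spike or a boundary edge; every finite layerable $\partial$-graph has one (adjoin all isolated boundary vertices of a given filtration first). All sub-$\partial$-graphs carry the restrictions of $w$ and $d$. Consistent labelling: for $K'$ obtained from $K$ by adjoining a boundary spike $e$, bijections $\ell:\{1,\dots,m\}\to\partial V(K)$ and $\ell':\{1,\dots,m\}\to\partial V(K')$ are consistent if $e_-\in\partial V(K)$ and $e_+\in\partial V(K')$ have the same index and every vertex of $\partial V(K)\cap\partial V(K')$ has the same index under both; for a boundary edge, if $\ell=\ell'$. A labelling of a filtration is consistent if consecutive labellings are consistent. Boundary data transformations ($2m\times2m$ in $m\times m$ blocks, $E_{p,q}$ the matrix units): for adjoining a boundary spike $e$ with index $k$ of $e_-,e_+$, $w=w(e)$, $\delta=d(e_+)$ (with $e_+$ the newly added vertex): \[ \begin{pmatrix} I & w^{-1}E_{k,k} \\ \delta E_{k,k} & I+\delta w^{-1}E_{k,k}\end{pmatrix}; \] for adjoining a boundary edge $e$ whose endpoints have indices $p,q$, $w=w(e)$: \[ \begin{pmatrix} I & 0 \\ w(E_{p,p}+E_{q,q}-E_{p,q}-E_{q,p})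 & I\end{pmatrix}. \] *)

(* Defs.v *)
From HB Require Import structures.
From mathcomp Require Import all_boot all_order all_algebra.

Set Implicit Arguments.
Unset Strict Implicit.
Unset Printing Implicit Defensive.
Set Warnings "-redundant-canonical-projection,-projection-no-head-constant".

Import GRing.Theory.
Local Open Scope ring_scope.

(* Every undirected edge, loops included, is represented by two distinct
   oriented edges exchanged by [erev]; [src e] is $e_+$ and [tgt e] is $e_-$. *)
Record multigraph := Multigraph {
  vertex :> finType;
  edge : finType;
  src : edge -> vertex;
  tgt : edge -> vertex;
  erev : edge -> edge;
  erevK : involutive erev;
  erev_neq : forall e, erev e != e;
  src_erev : forall e, src (erev e) = tgt e
}.

Record dgraph := DGraph {
  graph_of :> multigraph;
  interior : {set graph_of}
}.

Definition boundary (G : dgraph) : {set G} := ~: interior G.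

Definition to_boundary (G : dgraph) (S : {set G}) : dgraph :=
  DGraph (interior G :\: S).

(* Raw data of a sub-$\partial$-graph of a fixed multigraph; it describes an
   actual sub-$\partial$-graph when [sub_dgraph_wf] holds. *)
Record sub_dgraph (X : multigraph) := SubDGraph {
  verts : {set X};
  inter : {set X};
  edges : {set edge X}
}.

Definition sub_dgraph_wf (X : multigraph) (K : sub_dgraph X) : Prop :=
  inter K \subset verts K /\
  forall e, e \in edges K -> (erev e \in edges K) && (src e \in verts K).

Definition bdry (X : multigraph) (K : sub_dgraph X) : {set X} :=
  verts K :\: inter K.

Definition whole (G : dgraph) : sub_dgraph G :=
  SubDGraph setT (interior G) setT.

Definition empty_sub (X : multigraph) : sub_dgraph X :=
  SubDGraph set0 set0 set0.

(* In the three operations [K] is the smaller graph and [K'] the larger one. *)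

Definition adjoin_isolated (X : multigraph) (x : X) (K K' : sub_dgraph X)
    : Prop :=
  [/\ x \notin verts K,
      verts K' = x |: verts K,
      inter K' = inter K,
      edges K' = edges K &
      x \in bdry K' /\ forall f, f \in edges K' -> src f != x].

Definition adjoin_spike (X : multigraph) (e : edge X) (K K' : sub_dgraph X)
    : Prop :=
  [/\ src e \notin verts K /\ verts K' = src e |: verts K,
      [/\ e \notin edges K, erev e \notin edges K &
          edges K' = e |: (erev e |: edges K)],
      tgt e \in bdry K /\ inter K' = tgt e |: inter K,
      src e \in bdry K' &
      forall f, f \in edges K' -> src f = src e -> f = e].

Definition adjoin_edge (X : multigraph) (e : edge X) (K K' : sub_dgraph X)
    : Prop :=
  [/\ verts K' = verts K,
      inter K' = inter K,
      [/\ e \notin edges K, erev e \notin edges K &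
          edges K' = e |: (erev e |: edges K)],
      src e \in bdry K' &
      tgt e \in bdry K'].

Inductive layerable_sub (X : multigraph) : sub_dgraph X -> Prop :=
| layerable_empty : layerable_sub (empty_sub X)
| layerable_isolated x K K' :
    layerable_sub K -> adjoin_isolated x K K' -> layerable_sub K'
| layerable_spike e K K' :
    layerable_sub K -> adjoin_spike e K K' -> layerable_sub K'
| layerable_edge e K K' :
    layerable_sub K -> adjoin_edge e K K' -> layerable_sub K'.

Definition layerable (G : dgraph) : Prop := layerable_sub (whole G).

Definition isolated_boundary (X : multigraph) (K : sub_dgraph X) : Prop :=
  inter K = set0 /\ edges K = set0.

Definition std_filtration (X : multigraph) (n : nat)
    (F : nat -> sub_dgraph X) (K : sub_dgraph X) : Prop :=
  [/\ forall j, (j <= n)%N -> sub_dgraph_wf (F j),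
      isolated_boundary (F 0%N),
      forall j, (j < n)%N ->
        exists e, adjoin_spike e (F j) (F j.+1) \/ adjoin_edge e (F j) (F j.+1) &
      F n = K].

Definition dual_sub (G : dgraph) (K : sub_dgraph G) : sub_dgraph G :=
  SubDGraph (verts (whole G) :\: inter K)
            (verts (whole G) :\: verts K)
            (edges (whole G) :\: edges K).

Record laplacian (R : comPzRingType) (X : multigraph) := Laplacian {
  weight : edge X -> R;
  weight_erev : forall e, weight (erev e) = weight e;
  diag : X -> R
}.

(* [GRing.unit] is only available on the nontrivial rings [unitRingType]. *)
Definition invertible (R : comPzRingType) (a : R) : Prop :=
  exists b, a * b = 1.

Definition is_network (R : comPzRingType) (X : multigraph)
    (L : laplacian R X) : Prop :=
  forall e, invertible (weight L e).

Definition lap (R : comPzRingType) (X : multigraph) (L : laplacian R X)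
    (M : lmodType R) (u : {ffun X -> M}) : {ffun X -> M} :=
  [ffun x => diag L x *: u x +
             \sum_(e | src e == x) weight L e *: (u x - u (tgt e))].

Definition mxact (R : comPzRingType) (m s : nat) (A : 'M[R]_(m, s))
    (M : lmodType R) (u : {ffun 'I_s -> M}) : {ffun 'I_m -> M} :=
  [ffun i => \sum_j A i j *: u j].

(* A submodule of [V]; [submod S] is [S] viewed as an [R]-module. *)
Record submodule (R : comPzRingType) (V : lmodType R) := Submodule {
  submod_pred : {pred V};
  submod_closedP : submod_closed submod_pred
}.

HB.instance Definition _ (R : comPzRingType) (V : lmodType R)
    (S : submodule V) :=
  GRing.isSubmodClosed.Build R V (submod_pred S) (submod_closedP S).

Inductive submod (R : comPzRingType) (V : lmodType R) (S : submodule V) :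
    predArgType := Submod u & u \in submod_pred S.

Definition submod_val (R : comPzRingType) (V : lmodType R) (S : submodule V)
    (w : submod S) : V := let: Submod u _ := w in u.

HB.instance Definition _ (R : comPzRingType) (V : lmodType R)
    (S : submodule V) := [isSub of submod S for @submod_val R V S].
HB.instance Definition _ (R : comPzRingType) (V : lmodType R)
    (S : submodule V) := [Choice of submod S by <:].
HB.instance Definition _ (R : comPzRingType) (V : lmodType R)
    (S : submodule V) := [SubChoice_isSubZmodule of submod S by <:].
HB.instance Definition _ (R : comPzRingType) (V : lmodType R)
    (S : submodule V) := [SubZmodule_isSubLmodule of submod S by <:].

Definition lmod_iso (R : comPzRingType) (U W : lmodType R) : Prop :=
  exists f : {linear U -> W}, bijective f.

Definition U0_pred (R : comPzRingType) (G : dgraph) (L : laplacian R G)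
    (M : lmodType R) : {pred {ffun G -> M}} :=
  [pred u | [forall x, lap L u x == 0] &&
            [forall x in boundary G, u x == 0]].
Arguments U0_pred {R G} L M.

Lemma U0_submod_closed (R : comPzRingType) (G : dgraph) (L : laplacian R G)
  (M : lmodType R) : submod_closed (U0_pred L M).
Proof.
split=> [|a u v]; rewrite !inE.
  apply/andP; split; apply/forallP=> x; last by rewrite ffunE eqxx implybT.
  rewrite !ffunE scaler0 add0r big1 // => e _.
  by rewrite !ffunE subrr scaler0.
case/andP=> /forallP Lu /forallP u0 /andP[/forallP Lv /forallP v0].
apply/andP; split; apply/forallP=> x; last first.
  apply/implyP=> bx; rewrite !ffunE.
  have /eqP-> := implyP (u0 x) bx; have /eqP-> := implyP (v0 x) bx.
  by rewrite scaler0 addr0.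
have -> : lap L (a *: u + v) x = a *: lap L u x + lap L v x.
  rewrite !ffunE !scalerDr scaler_sumr addrACA -big_split /= !scalerA.
  rewrite (mulrC a); congr (_ + _); apply: eq_bigr => e _.
  by rewrite !ffunE opprD addrACA scalerDr -scalerBr !scalerA mulrC.
by rewrite (eqP (Lu x)) (eqP (Lv x)) scaler0 addr0.
Qed.

Definition U0 (R : comPzRingType) (G : dgraph) (L : laplacian R G)
    (M : lmodType R) : lmodType R := submod (Submodule (@U0_submod_closed R G L M)).

Definition mxker_pred (R : comPzRingType) (m s : nat) (A : 'M[R]_(m, s))
    (M : lmodType R) : {pred {ffun 'I_s -> M}} :=
  [pred u | mxact A u == 0].
Arguments mxker_pred {R m s} A M.

Lemma mxker_submod_closed (R : comPzRingType) (m s : nat) (A : 'M[R]_(m, s))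
  (M : lmodType R) : submod_closed (mxker_pred A M).
Proof.
split=> [|a u v]; rewrite !inE.
  by apply/eqP/ffunP=> i; rewrite !ffunE big1 // => j _; rewrite ffunE scaler0.
move=> /eqP Au /eqP Av.
have -> : mxact A (a *: u + v) = a *: mxact A u + mxact A v.
  apply/ffunP=> i; rewrite !ffunE scaler_sumr -big_split /=.
  by apply: eq_bigr => j _; rewrite !ffunE scalerDr !scalerA mulrC.
by rewrite Au Av scaler0 addr0.
Qed.

Definition mxker (R : comPzRingType) (m s : nat) (A : 'M[R]_(m, s))
    (M : lmodType R) : lmodType R := submod (Submodule (@mxker_submod_closed R m s A M)).

(* The index set $\{1,\dots,m\}$ is ['I_m], i.e. indices start at 0. *)
Definition is_labelling (X : multigraph) (m : nat) (K : sub_dgraph X)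
    (l : 'I_m -> X) : Prop :=
  injective l /\ [set l i | i : 'I_m] = bdry K.

Definition consistent (X : multigraph) (m : nat) (K K' : sub_dgraph X)
    (l l' : 'I_m -> X) : Prop :=
  (forall e, adjoin_spike e K K' ->
     (exists k, l k = tgt e /\ l' k = src e) /\
     (forall i i', l i \in bdry K :&: bdry K' -> l i = l' i' -> i = i')) /\
  (forall e, adjoin_edge e K K' -> l =1 l').

(* [T] is the boundary data transformation for the operation $K\mapsto K'$;
   [v] is the inverse of the weight of the added edge. *)
Inductive bdry_transform (R : comPzRingType) (X : multigraph)
    (L : laplacian R X) (m : nat) (K K' : sub_dgraph X) (l l' : 'I_m -> X) :
    'M[R]_(m + m) -> Prop :=
| bdry_transform_spike e k v :
    adjoin_spike e K K' -> l k = tgt e -> l' k = src e ->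
    weight L e * v = 1 ->
    bdry_transform L K K' l l'
      (block_mx 1%:M (v *: delta_mx k k)
                (diag L (src e) *: delta_mx k k)
                (1%:M + (diag L (src e) * v) *: delta_mx k k))
| bdry_transform_edge e p q :
    adjoin_edge e K K' -> l p = src e -> l q = tgt e ->
    bdry_transform L K K' l l'
      (block_mx 1%:M 0
                (weight L e *: (delta_mx p p + delta_mx q q
                                - delta_mx p q - delta_mx q p))
                1%:M).

(* A consistent labelling of the filtration $H_n\subseteq\dots\subseteq H_0$
   with $\ell_n(\{1,\dots,s\})=S$. *)
Definition good_labelling (X : multigraph) (m n s : nat)
    (H : nat -> sub_dgraph X) (S : {set X}) (l : nat -> 'I_m -> X) : Prop :=
  [/\ forall j, (j <= n)%N -> is_labelling (H j) (l j),
      forall j, (j < n)%N -> consistent (H j.+1) (H j) (l j.+1) (l j) &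
      [set l n i | i : 'I_m & (i < s)%N] = S].

Definition good_transforms (R : comPzRingType) (X : multigraph)
    (L : laplacian R X) (m n : nat) (H : nat -> sub_dgraph X)
    (l : nat -> 'I_m -> X) (T : nat -> 'M[R]_(m + m)) : Prop :=
  T n = block_mx 1%:M 0 (diag_mx (\row_i diag L (l n i))) 1%:M /\
  forall j, (j < n)%N ->
    bdry_transform L (H j.+1) (H j) (l j.+1) (l j) (T j).

(* [pid_mx s] is the block column with blocks $I_s$ and 0. *)
Definition layer_matrix (R : comPzRingType) (m n s : nat)
    (T : nat -> 'M[R]_(m + m)) : 'M[R]_(m, s) :=
  row_mx 0 1%:M *m (\prod_(j < n.+1) T j) *m pid_mx s.

(* Main.v *)
Require Import Defs.
From HB Require Import structures.
From mathcomp Require Import all_boot all_order all_algebra.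
Local Open Scope ring_scope.

Set Implicit Arguments.
Unset Strict Implicit.
Unset Printing Implicit Defensive.

Import GRing.Theory.

(** Write [H j] for the complement of the [j]-th stage of the filtration, so
    that [H n] consists of the isolated vertices of [S] and of the boundary of
    [G], and [H 0] contains all vertices and edges.  Passing from [H j.+1] to
    [H j] adds an edge: either a boundary edge, or a boundary spike, namely the
    reverse of the spike of the original filtration.  The point is that all the
    edges at a vertex are present as soon as that vertex becomes interior
    ([std_late_edge]), so that complementation does turn spikes into spikes
    ([dual_adjoins]).

    Follow a function [u] along the chain by recording, on each [H j], its
    boundary values and the boundary values of its Laplacian.  When a spike is
    adjoined, its inner end becomes interior, and the vanishing of the Laplacian
    there determines [u] at the new vertex, because the weight is invertible.
    Hence a function harmonic on the smaller graph extends to the larger one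
    ([harmonic_extend]) in a unique way ([harmonic_unique]), and the boundary
    data change by the boundary data transformation ([bdata_adjoin]).

    On [H n] there are no edges, every function is harmonic, and the Laplacian
    is multiplication by the diagonal term, which is [T n].  So a function on
    [S], extended by zero to the boundary of [G], extends uniquely to a function
    harmonic on [H 0], whose Laplacian on the boundary of [H 0] is given by the
    matrix of the theorem.  The elements of [U0] are exactly the extensions for
    which this Laplacian vanishes, and restriction to [S] is the isomorphism
    ([U0_iso_layer_matrix]). *)

(** * Matrices acting on tuples of module elements *)

Lemma mxactM (R : comPzRingType) (m n p : nat) (A : 'M[R]_(m, n))
    (B : 'M[R]_(n, p)) (M : lmodType R) (u : {ffun 'I_p -> M}) :
  mxact (A *m B) u = mxact A (mxact B u).
Proof.
apply/ffunP=> i; rewrite !ffunE.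
under [RHS]eq_bigr => j _ do rewrite ffunE scaler_sumr.
rewrite exchange_big /=; apply: eq_bigr => k _.
rewrite mxE scaler_suml; apply: eq_bigr => j _.
by rewrite scalerA.
Qed.

(* Unlike [ffunE], these leave the entries of [mxact A u] folded. *)
Lemma add_ffunE (I : finType) (M : zmodType) (u v : {ffun I -> M}) (i : I) :
  (u + v) i = u i + v i.
Proof. by rewrite ffunE. Qed.

Lemma opp_ffunE (I : finType) (M : zmodType) (u : {ffun I -> M}) (i : I) :
  (- u) i = - u i.
Proof. by rewrite ffunE. Qed.

Lemma scale_ffunE (R : comPzRingType) (I : finType) (M : lmodType R) (a : R)
    (u : {ffun I -> M}) (i : I) : (a *: u) i = a *: u i.
Proof. by rewrite ffunE. Qed.

Lemma mxactD (R : comPzRingType) (m n : nat) (A B : 'M[R]_(m, n))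
    (M : lmodType R) (u : {ffun 'I_n -> M}) :
  mxact (A + B) u = mxact A u + mxact B u.
Proof.
apply/ffunP=> i; rewrite !ffunE -big_split /=.
by apply: eq_bigr => j _; rewrite mxE scalerDl.
Qed.

Lemma mxactZ (R : comPzRingType) (m n : nat) (a : R) (A : 'M[R]_(m, n))
    (M : lmodType R) (u : {ffun 'I_n -> M}) :
  mxact (a *: A) u = a *: mxact A u.
Proof.
apply/ffunP=> i; rewrite !ffunE scaler_sumr.
by apply: eq_bigr => j _; rewrite mxE scalerA.
Qed.

Lemma mxactN (R : comPzRingType) (m n : nat) (A : 'M[R]_(m, n))
    (M : lmodType R) (u : {ffun 'I_n -> M}) :
  mxact (- A) u = - mxact A u.
Proof. by rewrite -scaleN1r mxactZ scaleN1r. Qed.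

Lemma mxact0 (R : comPzRingType) (m n : nat) (M : lmodType R)
    (u : {ffun 'I_n -> M}) : mxact (0 : 'M[R]_(m, n)) u = 0.
Proof.
by apply/ffunP=> i; rewrite !ffunE big1 // => j _; rewrite mxE scale0r.
Qed.

Lemma mxact_delta (R : comPzRingType) (m n : nat) (p : 'I_m) (q : 'I_n)
    (M : lmodType R) (u : {ffun 'I_n -> M}) (i : 'I_m) :
  mxact (delta_mx p q : 'M[R]_(m, n)) u i = if i == p then u q else 0.
Proof.
rewrite ffunE (bigD1 q) //= big1 => [|j jq]; last first.
  by rewrite mxE (negPf jq) andbF scale0r.
by rewrite mxE eqxx andbT addr0; case: eqP => _; rewrite ?scale1r ?scale0r.
Qed.

Lemma mxact_diag (R : comPzRingType) (m : nat) (a : 'rV[R]_m)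
    (M : lmodType R) (u : {ffun 'I_m -> M}) (i : 'I_m) :
  mxact (diag_mx a) u i = a 0 i *: u i.
Proof.
rewrite ffunE (bigD1 i) //= big1 => [|j jq]; last first.
  by rewrite mxE eq_sym (negPf jq) scale0r.
by rewrite mxE eqxx mulr1n addr0.
Qed.

Lemma mxact1 (R : comPzRingType) (m : nat) (M : lmodType R)
    (u : {ffun 'I_m -> M}) : mxact (1%:M : 'M[R]_m) u = u.
Proof.
apply/ffunP=> i; rewrite ffunE (bigD1 i) //= big1 => [|j jq]; last first.
  by rewrite mxE eq_sym (negPf jq) scale0r.
by rewrite mxE eqxx scale1r addr0.
Qed.

(** The block column with upper part [a] and lower part [b]. *)
Definition stack (m1 m2 : nat) (M : Type) (a : {ffun 'I_m1 -> M})
    (b : {ffun 'I_m2 -> M}) : {ffun 'I_(m1 + m2) -> M} :=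
  [ffun i => match split i with inl j => a j | inr j => b j end].

Lemma stack_lshift (m1 m2 : nat) (M : Type) (a : {ffun 'I_m1 -> M})
    (b : {ffun 'I_m2 -> M}) (i : 'I_m1) : stack a b (lshift m2 i) = a i.
Proof. by rewrite ffunE (unsplitK (inl i)). Qed.

Lemma stack_rshift (m1 m2 : nat) (M : Type) (a : {ffun 'I_m1 -> M})
    (b : {ffun 'I_m2 -> M}) (i : 'I_m2) : stack a b (rshift m1 i) = b i.
Proof. by rewrite ffunE (unsplitK (inr i)). Qed.

Lemma stackP (m1 m2 : nat) (M : Type) (c c' : {ffun 'I_(m1 + m2) -> M}) :
  (forall i, c (lshift m2 i) = c' (lshift m2 i)) ->
  (forall i, c (rshift m1 i) = c' (rshift m1 i)) -> c = c'.
Proof.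
move=> cl cr; apply/ffunP=> i; rewrite -(splitK i).
by case: (split i) => j; [apply: cl | apply: cr].
Qed.

Lemma mxact_block (R : comPzRingType) (m1 m2 n1 n2 : nat)
    (A : 'M[R]_(m1, n1)) (B : 'M[R]_(m1, n2)) (C : 'M[R]_(m2, n1))
    (D : 'M[R]_(m2, n2)) (M : lmodType R) (a : {ffun 'I_n1 -> M})
    (b : {ffun 'I_n2 -> M}) :
  mxact (block_mx A B C D) (stack a b) =
  stack (mxact A a + mxact B b) (mxact C a + mxact D b).
Proof.
apply: stackP => i; rewrite ?stack_lshift ?stack_rshift !ffunE big_split_ord.
  congr (_ + _); apply: eq_bigr => j _.
    by rewrite block_mxEul stack_lshift.
  by rewrite block_mxEur stack_rshift.
congr (_ + _); apply: eq_bigr => j _.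
  by rewrite block_mxEdl stack_lshift.
by rewrite block_mxEdr stack_rshift.
Qed.

Lemma mxact_row01 (R : comPzRingType) (m : nat) (M : lmodType R)
    (c : {ffun 'I_(m + m) -> M}) :
  mxact (row_mx 0 1%:M : 'M[R]_(m, m + m)) c = [ffun i => c (rshift m i)].
Proof.
apply/ffunP=> i; rewrite !ffunE big_split_ord /= big1 => [|j _]; last first.
  by rewrite row_mxEl mxE scale0r.
rewrite add0r (bigD1 i) //= big1 => [|j ji]; last first.
  by rewrite row_mxEr mxE eq_sym (negPf ji) scale0r.
by rewrite row_mxEr mxE eqxx scale1r addr0.
Qed.

(** The tuple [a] padded with zeros to length [m]. *)
Definition pad (m s : nat) (M : nmodType) (a : {ffun 'I_s -> M}) :
    {ffun 'I_m -> M} :=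
  [ffun i : 'I_m => oapp (fun j : 'I_s => a j) 0 (insub (val i))].

Lemma mxact_pid (R : comPzRingType) (m s : nat) (M : lmodType R)
    (a : {ffun 'I_s -> M}) :
  mxact (pid_mx s : 'M[R]_(m, s)) a = pad m a.
Proof.
apply/ffunP=> i; rewrite !ffunE; case: insubP => [j js ji | si].
  rewrite (bigD1 j) //= big1 => [|k kj]; last first.
    by rewrite mxE -ji val_eqE eq_sym (negPf kj) scale0r.
  by rewrite mxE -ji eqxx ltn_ord scale1r addr0.
by rewrite big1 // => j _; rewrite mxE (negPf si) andbF scale0r.
Qed.

Lemma pad_add (m s : nat) (M : nmodType) (a : {ffun 'I_s -> M}) :
  (s <= m)%N -> pad (m + m) a = stack (pad m a) 0.
Proof.
move=> sm; apply: stackP => i; rewrite ?stack_lshift ?stack_rshift !ffunE //=.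
by rewrite insubF //; apply: negbTE; rewrite -leqNgt (leq_trans sm) ?leq_addr.
Qed.

Lemma mxact_prod (R : comPzRingType) (m n : nat) (T : nat -> 'M[R]_m)
    (M : lmodType R) (c : nat -> {ffun 'I_m -> M}) :
  (forall j, (j < n)%N -> c j = mxact (T j) (c j.+1)) ->
  c 0%N = mxact (\prod_(j < n) T j) (c n).
Proof.
elim: n => [|n IHn] cT; first by rewrite big_ord0 mxact1.
rewrite big_ord_recr /= -mulmxE mxactM -cT //.
by apply: IHn => j /leqW/cT.
Qed.

(** * Boundary data of functions on sub-graphs *)

(** The Laplacian of the sub-graph [K], which carries the restricted weights. *)
Definition sub_lap (R : comPzRingType) (X : multigraph) (L : laplacian R X)
    (M : lmodType R) (K : sub_dgraph X) (u : {ffun X -> M}) (x : X) : M :=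
  diag L x *: u x +
  \sum_(f in edges K | src f == x) weight L f *: (u x - u (tgt f)).

(** [u] is harmonic on [K]: its Laplacian vanishes at the interior vertices.
    Although [u] is defined on all of [X], only its values on [K] matter
    ([sub_lap_eq]). *)
Definition harmonic (R : comPzRingType) (X : multigraph) (L : laplacian R X)
    (M : lmodType R) (K : sub_dgraph X) (u : {ffun X -> M}) : Prop :=
  forall x, x \in inter K -> sub_lap L K u x = 0.

(** The boundary values of [u] above the boundary values of its Laplacian. *)
Definition bdata (R : comPzRingType) (X : multigraph) (L : laplacian R X)
    (M : lmodType R) (m : nat) (K : sub_dgraph X) (l : 'I_m -> X)
    (u : {ffun X -> M}) : {ffun 'I_(m + m) -> M} :=
  stack [ffun i => u (l i)] [ffun i => sub_lap L K u (l i)].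

Lemma tgt_erev (X : multigraph) (e : edge X) : tgt (erev e) = src e.
Proof. by rewrite -src_erev erevK. Qed.

Lemma wf_src (X : multigraph) (K : sub_dgraph X) (f : edge X) :
  sub_dgraph_wf K -> f \in edges K -> src f \in verts K.
Proof. by case=> _ wfK /wfK /andP[]. Qed.

Lemma wf_tgt (X : multigraph) (K : sub_dgraph X) (f : edge X) :
  sub_dgraph_wf K -> f \in edges K -> tgt f \in verts K.
Proof.
by move=> wfK fK; case: (wfK) => _ /(_ f fK) /andP[/(wf_src wfK)]; rewrite src_erev.
Qed.

Lemma sub_lap_eq (R : comPzRingType) (X : multigraph) (L : laplacian R X)
    (M : lmodType R) (K : sub_dgraph X) (u u' : {ffun X -> M}) (x : X) :
  sub_dgraph_wf K -> {in verts K, u' =1 u} -> x \in verts K ->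
  sub_lap L K u' x = sub_lap L K u x.
Proof.
move=> wfK uu' xK; rewrite /sub_lap uu' //; congr (_ + _).
by apply: eq_bigr => f /andP[fK _]; rewrite uu' // wf_tgt.
Qed.

(** This applies to the new vertex of a spike, before the spike is adjoined. *)
Lemma sub_lap_notin (R : comPzRingType) (X : multigraph) (L : laplacian R X)
    (M : lmodType R) (K : sub_dgraph X) (u : {ffun X -> M}) (x : X) :
  sub_dgraph_wf K -> x \notin verts K -> sub_lap L K u x = diag L x *: u x.
Proof.
move=> wfK xK; rewrite /sub_lap big1 ?addr0 // => f /andP[fK /eqP fx].
by rewrite -fx wf_src in xK.
Qed.

(* The two orientations of the new edge contribute separately, so that the
   formula also covers loops. *)
Lemma sub_lap_adjoin (R : comPzRingType) (X : multigraph) (L : laplacian R X)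
    (M : lmodType R) (K K' : sub_dgraph X) (e : edge X) (u : {ffun X -> M})
    (x : X) :
  e \notin edges K -> erev e \notin edges K ->
  edges K' = e |: (erev e |: edges K) ->
  sub_lap L K' u x = sub_lap L K u x +
    ((if src e == x then weight L e *: (u x - u (tgt e)) else 0) +
     (if tgt e == x then weight L e *: (u x - u (src e)) else 0)).
Proof.
move=> eK rK defK'; rewrite /sub_lap -addrA; congr (_ + _).
rewrite !big_mkcondr /= defK' !big_setU1 //=; last first.
  by rewrite !inE eq_sym (negPf (erev_neq e)).
by rewrite src_erev tgt_erev weight_erev addrA [LHS]addrC.
Qed.

Lemma mem_bdry (X : multigraph) (K : sub_dgraph X) (x : X) :
  (x \in bdry K) = (x \notin inter K) && (x \in verts K).
Proof. by rewrite /bdry !inE. Qed.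

Lemma is_labelling_bdry (X : multigraph) (m : nat) (K : sub_dgraph X)
    (l : 'I_m -> X) (i : 'I_m) : is_labelling K l -> l i \in bdry K.
Proof. by case=> _ <-; apply: imset_f. Qed.

Lemma bdry_verts (X : multigraph) (K : sub_dgraph X) (x : X) :
  x \in bdry K -> x \in verts K.
Proof. by case/setDP. Qed.

Lemma bdry_inter (X : multigraph) (K : sub_dgraph X) (x : X) :
  x \in bdry K -> x \notin inter K.
Proof. by case/setDP. Qed.

Lemma spike_src_neq_tgt (X : multigraph) (K K' : sub_dgraph X) (e : edge X) :
  adjoin_spike e K K' -> src e != tgt e.
Proof.
case=> [[sK _] _ [/bdry_verts tK _] _ _].
by apply: contraNneq sK => ->.
Qed.

(** Across a spike, only the label of its inner end changes. *)
Lemma spike_labels_off (X : multigraph) (m : nat) (K K' : sub_dgraph X)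
    (e : edge X) (l l' : 'I_m -> X) (k i : 'I_m) :
  adjoin_spike e K K' -> is_labelling K l -> is_labelling K' l' ->
  consistent K K' l l' -> l k = tgt e -> i != k -> l' i = l i.
Proof.
move=> sp labl labl' [cons _] lk ik.
have [_ fixl] := cons e sp.
have liK := is_labelling_bdry i labl.
have liK' : l i \in bdry K'.
  case: sp => [[_ vK'] _ [tK iK'] _ _].
  rewrite mem_bdry iK' vK' !inE (bdry_verts liK) orbT andbT negb_or.
  by rewrite bdry_inter // -lk (inj_eq labl.1) ik.
case: (labl') => _ defK'; move: (liK'); rewrite -defK' => /imsetP[i' _ li].
rewrite li; have -> // : i = i' by apply: fixl => //; rewrite inE liK.
Qed.

(** The boundary data transformation carries the boundary data on the smaller
    graph to those on the larger one. *)
Lemma bdata_adjoin (R : comPzRingType) (X : multigraph) (L : laplacian R X)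
    (M : lmodType R) (m : nat) (K K' : sub_dgraph X) (l l' : 'I_m -> X)
    (T : 'M[R]_(m + m)) (u : {ffun X -> M}) :
  sub_dgraph_wf K -> is_labelling K l -> is_labelling K' l' ->
  consistent K K' l l' -> bdry_transform L K K' l l' T ->
  harmonic L K' u ->
  harmonic L K u /\ bdata L K' l' u = mxact T (bdata L K l u).
Proof.
move=> wfK labl labl' cons [e k v sp lk l'k wv | e p q ed lp lq] hu; last first.
  case: (ed) => vK' iK' [eK rK eK'] sb tb.
  have lapE := sub_lap_adjoin L u _ eK rK eK'.
  have ll' := cons.2 e ed.
  split=> [x xK|].
    have := hu x; rewrite iK' => /(_ xK); rewrite lapE.
    rewrite ifN ?ifN ?addr0 //.
      by apply: contraTneq tb => ->; rewrite mem_bdry iK' xK.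
    by apply: contraTneq sb => ->; rewrite mem_bdry iK' xK.
  rewrite /bdata mxact_block mxact1 mxact0 addr0 mxactZ !mxactD !mxactN mxact1.
  congr stack; apply/ffunP=> i.
    by rewrite !ffunE ll'.
  rewrite !(add_ffunE, opp_ffunE, scale_ffunE) !mxact_delta !ffunE -!ll' lapE.
  rewrite [RHS]addrC; congr (_ + _).
  rewrite -lp -lq !(inj_eq labl.1) ![_ == i]eq_sym.
  case: eqP => [->|_]; case: eqP => [->|_];
    rewrite ?addr0 ?add0r ?subr0 ?oppr0 ?sub0r ?scaler0 //.
  (* Both endpoints coincide: a loop contributes nothing. *)
  by rewrite !subrr !scaler0 addr0 addrK subrr scaler0.
have st := spike_src_neq_tgt sp.
case: (sp) => [[sK vK'] [eK rK eK'] [tK iK'] sK' _].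
have lapE := sub_lap_adjoin L u _ eK rK eK'.
(* The equation at [tgt e], which has become interior. *)
have lap_t : sub_lap L K u (tgt e) = weight L e *: (u (src e) - u (tgt e)).
  have := hu (tgt e); rewrite iK' setU11 => /(_ isT).
  rewrite lapE eqxx (negPf st) add0r => /eqP; rewrite addr_eq0 => /eqP ->.
  by rewrite -scalerN opprB.
have u_s : u (src e) = u (tgt e) + v *: sub_lap L K u (tgt e).
  by rewrite lap_t scalerA mulrC wv scale1r addrC subrK.
have lap_s : sub_lap L K' u (src e) =
    diag L (src e) *: u (src e) + sub_lap L K u (tgt e).
  rewrite lapE eqxx eq_sym (negPf st) addr0 lap_t sub_lap_notin //.
split=> [x xK|].
  have := hu x; rewrite iK' inE xK orbT => /(_ isT); rewrite lapE.
  rewrite ifN ?ifN ?addr0 //.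
    by apply: contraTneq tK => ->; rewrite mem_bdry xK.
  by apply: contraNneq sK => ->; case: wfK => /subsetP ->.
rewrite /bdata mxact_block mxact1 mxactD !mxactZ mxact1.
congr stack; apply/ffunP=> i.
  rewrite add_ffunE scale_ffunE mxact_delta !ffunE; case: eqP => [->|/eqP ik].
    by rewrite l'k lk u_s.
  by rewrite scaler0 addr0 (spike_labels_off sp labl labl' cons lk).
rewrite !(add_ffunE, scale_ffunE) !mxact_delta !ffunE.
case: eqP => [->|/eqP ik].
  rewrite l'k lk lap_s [in LHS]u_s scalerDr scalerA -addrA; congr (_ + _).
  by rewrite addrC.
rewrite !scaler0 add0r addr0 (spike_labels_off sp labl labl' cons lk) //.
rewrite lapE ifN ?ifN ?addr0 //.
  by rewrite -lk (inj_eq labl.1) eq_sym.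
apply: contraNneq sK => ->; exact/bdry_verts/is_labelling_bdry.
Qed.

(** * Chains of adjunctions *)

(** [K'] arises from [K] by adjoining one boundary spike or boundary edge. *)
Definition adjoins (X : multigraph) (K K' : sub_dgraph X) : Prop :=
  exists e, adjoin_spike e K K' \/ adjoin_edge e K K'.

Lemma adjoins_verts (X : multigraph) (K K' : sub_dgraph X) :
  adjoins K K' -> verts K \subset verts K'.
Proof. by case=> e [[[_ ->]] | [->]] *; rewrite // subsetU1. Qed.

Lemma adjoins_inter (X : multigraph) (K K' : sub_dgraph X) :
  adjoins K K' -> inter K \subset inter K'.
Proof. by case=> e [[_ _ [_ ->]] | [_ ->]] *; rewrite // subsetU1. Qed.

Lemma harmonic_extend (R : comPzRingType) (X : multigraph) (L : laplacian R X)
    (M : lmodType R) (K K' : sub_dgraph X) (u : {ffun X -> M}) :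
  is_network L -> sub_dgraph_wf K -> adjoins K K' -> harmonic L K u ->
  exists2 u' : {ffun X -> M}, {in verts K, u' =1 u} & harmonic L K' u'.
Proof.
move=> hL wfK [e [sp | ed]] hu; last first.
  exists u => // x; case: ed => _ iK' [eK rK eK'] sb tb.
  rewrite (sub_lap_adjoin L u x eK rK eK') iK' => xK.
  rewrite hu // ifN ?ifN ?addr0 //.
    by apply: contraTneq tb => ->; rewrite mem_bdry iK' xK.
  by apply: contraTneq sb => ->; rewrite mem_bdry iK' xK.
have st := spike_src_neq_tgt sp.
case: sp => [[sK _] [eK rK eK'] [tK iK'] _ _].
have [v wv] := hL e.
(* The value at the new vertex is forced by the equation at [tgt e]. *)
pose u' : {ffun X -> M} :=
  [ffun x => if x == src e then u (tgt e) + v *: sub_lap L K u (tgt e)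
             else u x].
have u'K : {in verts K, u' =1 u}.
  by move=> x xK; rewrite ffunE ifN //; apply: contraNneq sK => <-.
exists u' => // x; rewrite (sub_lap_adjoin L u' x eK rK eK') iK' in_setU1.
case: eqP => [-> _ | /eqP xt /= xK].
  rewrite eqxx (negPf st) add0r (sub_lap_eq _ _ u'K) // ?bdry_verts //.
  rewrite !ffunE eqxx [tgt e == _]eq_sym (negPf st) opprD addrA subrr sub0r.
  by rewrite scalerN scalerA wv scale1r subrr.
have xvK : x \in verts K by case: wfK => /subsetP ->.
rewrite (sub_lap_eq _ _ u'K) // hu // ifN ?ifN ?addr0 // 1?eq_sym //.
by apply: contraNneq sK => <-.
Qed.

Lemma harmonic_unique (R : comPzRingType) (X : multigraph) (L : laplacian R X)
    (M : lmodType R) (K K' : sub_dgraph X) (u : {ffun X -> M}) :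
  is_network L -> sub_dgraph_wf K -> adjoins K K' -> harmonic L K' u ->
  {in verts K, forall x, u x = 0} -> {in verts K', forall x, u x = 0}.
Proof.
move=> hL wfK [e [sp | [-> _ _ _ _] //]] hu u0.
have st := spike_src_neq_tgt sp.
case: sp => [[sK ->] [eK rK eK'] [tK iK'] _ _] x.
have tvK := bdry_verts tK.
rewrite in_setU1 => /predU1P[-> | /u0 //].
have [v wv] := hL e.
have := hu (tgt e); rewrite iK' setU11 => /(_ isT).
rewrite (sub_lap_adjoin L u _ eK rK eK') eqxx (negPf st) add0r.
have u0' : {in verts K, u =1 (0 : {ffun X -> M})}.
  by move=> y /u0 ->; rewrite ffunE.
rewrite (sub_lap_eq _ _ u0') // u0 // sub0r /sub_lap big1 => [|f _]; last first.
  by rewrite !ffunE subrr scaler0.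
rewrite ffunE scaler0 !add0r scalerN => /eqP; rewrite oppr_eq0 => /eqP w0.
by rewrite -[LHS]scale1r -wv mulrC -scalerA w0 scaler0.
Qed.

(** A chain of adjunctions, indexed downwards: [H 0] is the largest graph. *)
Definition chain (X : multigraph) (n : nat) (H : nat -> sub_dgraph X) : Prop :=
  (forall j, (j <= n)%N -> sub_dgraph_wf (H j)) /\
  (forall j, (j < n)%N -> adjoins (H j.+1) (H j)).

Lemma chain_shift (X : multigraph) (n : nat) (H : nat -> sub_dgraph X) :
  chain n.+1 H -> chain n (H \o S).
Proof. by case=> wfH adH; split=> j jn; [apply: wfH | apply: adH]. Qed.

Lemma chain_verts (X : multigraph) (n : nat) (H : nat -> sub_dgraph X) :
  chain n H -> verts (H n) \subset verts (H 0%N).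
Proof.
elim: n H => // n IHn H cH; apply: (subset_trans (IHn _ (chain_shift cH))).
exact/adjoins_verts/cH.2.
Qed.

Lemma chain_extend (R : comPzRingType) (X : multigraph) (L : laplacian R X)
    (M : lmodType R) (n : nat) (H : nat -> sub_dgraph X) (u : {ffun X -> M}) :
  is_network L -> chain n H -> harmonic L (H n) u ->
  exists2 u' : {ffun X -> M},
    {in verts (H n), u' =1 u} & harmonic L (H 0%N) u'.
Proof.
move=> hL; elim: n H => [|n IHn] H cH hu; first by exists u.
have cH' := chain_shift cH.
have [u1 eq1 h1] := IHn _ cH' hu.
have [u2 eq2 h2] := harmonic_extend hL (cH.1 1%N isT) (cH.2 0%N isT) h1.
exists u2 => // x xH; rewrite eq2 ?eq1 //.
exact: subsetP (chain_verts cH') _ xH.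
Qed.

Lemma chain_harmonic (R : comPzRingType) (X : multigraph) (L : laplacian R X)
    (M : lmodType R) (m n : nat) (H : nat -> sub_dgraph X)
    (l : nat -> 'I_m -> X) (T : nat -> 'M[R]_(m + m)) (u : {ffun X -> M}) :
  chain n H ->
  (forall j, (j <= n)%N -> is_labelling (H j) (l j)) ->
  (forall j, (j < n)%N -> consistent (H j.+1) (H j) (l j.+1) (l j)) ->
  (forall j, (j < n)%N ->
     bdry_transform L (H j.+1) (H j) (l j.+1) (l j) (T j)) ->
  harmonic L (H 0%N) u ->
  (forall j, (j <= n)%N -> harmonic L (H j) u) /\
  bdata L (H 0%N) (l 0%N) u =
    mxact (\prod_(j < n) T j) (bdata L (H n) (l n) u).
Proof.
move=> [wfH _] labl cons trT hu.
have step j : (j < n)%N -> harmonic L (H j) u -> harmonic L (H j.+1) u /\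
    bdata L (H j) (l j) u = mxact (T j) (bdata L (H j.+1) (l j.+1) u).
  move=> jn; apply: bdata_adjoin (trT j jn); [exact: wfH | exact: labl | |].
    exact/labl/ltnW.
  exact: cons.
have hH j : (j <= n)%N -> harmonic L (H j) u.
  by elim: j => // j IHj jn; case: (step j jn (IHj (ltnW jn))).
split=> //; apply: (mxact_prod (c := fun j => bdata L (H j) (l j) u)) => j jn.
by case: (step j jn (hH j (ltnW jn))).
Qed.

Lemma chain_unique (R : comPzRingType) (X : multigraph) (L : laplacian R X)
    (M : lmodType R) (n : nat) (H : nat -> sub_dgraph X) (u : {ffun X -> M}) :
  is_network L -> chain n H ->
  (forall j, (j <= n)%N -> harmonic L (H j) u) ->
  {in verts (H n), forall x, u x = 0} ->
  {in verts (H 0%N), forall x, u x = 0}.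
Proof.
move=> hL; elim: n H => // n IHn H cH hu u0.
apply: (harmonic_unique hL (cH.1 1%N isT) (cH.2 0%N isT) (hu 0%N isT)).
by apply: (IHn _ (chain_shift cH)) => // j jn; apply: hu.
Qed.

(** * The complementary filtration *)

(** New edges never start at a vertex that is already interior. *)
Lemma adjoins_new_edge (X : multigraph) (K K' : sub_dgraph X) (f : edge X) :
  sub_dgraph_wf K -> adjoins K K' -> f \in edges K' -> f \notin edges K ->
  src f \notin inter K.
Proof.
move=> wfK [e ad].
have [defK' sK tK] : [/\ edges K' = e |: (erev e |: edges K),
    src e \notin inter K & tgt e \notin inter K].
  case: ad => [[[sK _] [_ _ eK'] [tK _] _ _] | [_ iK' [_ _ eK'] sb tb]].
    split=> //; last exact: bdry_inter.
    by apply: contra sK; apply/subsetP; case: wfK.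
  by split; rewrite // -iK' bdry_inter.
rewrite defK' !inE => /or3P[/eqP-> // | /eqP-> | ->] //.
by rewrite src_erev.
Qed.

Lemma std_adjoins (X : multigraph) (n : nat) (F : nat -> sub_dgraph X)
    (K : sub_dgraph X) (j : nat) :
  std_filtration n F K -> (j < n)%N -> adjoins (F j) (F j.+1).
Proof. by case=> _ _ adF _; apply: adF. Qed.

Lemma std_inter (X : multigraph) (n : nat) (F : nat -> sub_dgraph X)
    (K : sub_dgraph X) (j k : nat) :
  std_filtration n F K -> (j <= k)%N -> (k <= n)%N ->
  inter (F j) \subset inter (F k).
Proof.
move=> stF; elim: k => [|k IHk]; first by rewrite leqn0 => /eqP->.
rewrite leq_eqVlt => /predU1P[-> // | jk] kn.
exact: subset_trans (IHk jk (ltnW kn)) (adjoins_inter (std_adjoins stF kn)).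
Qed.

Lemma std_verts (X : multigraph) (n : nat) (F : nat -> sub_dgraph X)
    (K : sub_dgraph X) (j : nat) :
  std_filtration n F K -> (j <= n)%N -> verts (F j) \subset verts K.
Proof.
move=> stF; have [_ _ _ <-] := stF.
have: forall k, (j <= k)%N -> (k <= n)%N -> verts (F j) \subset verts (F k).
  elim=> [|k IHk]; first by rewrite leqn0 => /eqP->.
  rewrite leq_eqVlt => /predU1P[-> // | jk] kn.
  exact: subset_trans (IHk jk (ltnW kn)) (adjoins_verts (std_adjoins stF kn)).
by move=> verts_le jn; apply: verts_le.
Qed.

(** Once a vertex is interior, all of its edges are present. *)
Lemma std_late_edge (X : multigraph) (n : nat) (F : nat -> sub_dgraph X)
    (K : sub_dgraph X) (j : nat) (f : edge X) :
  std_filtration n F K -> (j <= n)%N -> f \in edges K ->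
  f \notin edges (F j) -> src f \notin inter (F j).
Proof.
move=> stF; have [wfF _ _ <-] := stF.
have: forall k, (j <= k)%N -> (k <= n)%N -> f \in edges (F k) ->
    f \notin edges (F j) -> src f \notin inter (F j).
  elim=> [|k IHk]; first by rewrite leqn0 => /eqP-> _ ->.
  rewrite leq_eqVlt => /predU1P[<- _ -> // | jk] kn fk1 fj.
  have [fk | fk] := boolP (f \in edges (F k)); first exact: IHk jk (ltnW kn) fk fj.
  apply: contra (adjoins_new_edge (wfF k (ltnW kn)) (std_adjoins stF kn) fk1 fk).
  exact: (subsetP (std_inter (k := k) stF jk (ltnW kn))).
by move=> late jn; apply: late.
Qed.

Lemma bdry_dual (G : dgraph) (K : sub_dgraph G) : bdry (dual_sub K) = bdry K.
Proof.
by apply/setP=> x; rewrite !mem_bdry !inE !andbT negbK andbC.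
Qed.

Lemma dual_wf (G : dgraph) (K : sub_dgraph G) :
  sub_dgraph_wf K -> (forall f, f \notin edges K -> src f \notin inter K) ->
  sub_dgraph_wf (dual_sub K).
Proof.
move=> [iK eK] late; split=> [|e]; first exact: setDS.
rewrite !inE !andbT => eK'; rewrite (late e eK') andbT.
by apply: contra eK' => /eK/andP[]; rewrite erevK.
Qed.

(** Complementation exchanges adding a spike at its two ends. *)
Lemma dual_adjoins (G : dgraph) (K K' : sub_dgraph G) :
  sub_dgraph_wf K -> (forall f, f \notin edges K' -> src f \notin inter K') ->
  adjoins K K' -> adjoins (dual_sub K') (dual_sub K).
Proof.
move=> wfK late [e [sp | [vK' iK' [eK rK eK'] sb tb]]]; last first.
  exists e; right; split; rewrite /= ?vK' ?iK' ?bdry_dual //.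
  - split; rewrite ?eK' ?inE ?eqxx ?orbT //.
    apply/setP=> f; rewrite !inE !andbT !negb_or.
    have [-> | _] := eqVneq f e; first by rewrite eK.
    by have [-> | _] := eqVneq f (erev e); first by rewrite rK.
  - by move: sb; rewrite /bdry vK' iK'.
  - by move: tb; rewrite /bdry vK' iK'.
have st := spike_src_neq_tgt sp.
case: sp => [[sK vK'] [eK rK eK'] [tK iK'] sK' _].
have rt : src (erev e) = tgt e by rewrite src_erev.
exists (erev e); left; split; rewrite ?rt ?tgt_erev ?erevK ?bdry_dual //.
- split; first by rewrite /= !inE iK' setU11.
  apply/setP=> x; rewrite /= !inE !andbT iK' in_setU1 negb_or.
  by have [-> | _] := eqVneq x (tgt e); rewrite ?(bdry_inter tK).
- split; rewrite /= ?inE ?eK' ?inE ?eqxx ?orbT //.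
  apply/setP=> f; rewrite !inE !andbT !negb_or.
  have [-> | _] := eqVneq f e; first by rewrite eK orbT.
  by have [-> | _] := eqVneq f (erev e); first by rewrite rK.
- split=> //; apply/setP=> x; rewrite /= !inE !andbT vK' in_setU1 negb_or.
  by have [-> | _] := eqVneq x (src e); rewrite ?sK.
- move=> f; rewrite /= !inE andbT => fK ft.
  have [|/late] := boolP (f \in edges K'); last by rewrite ft iK' setU11.
  rewrite eK' !inE (negPf fK) orbF => /orP[/eqP fe | /eqP //].
  by rewrite -ft fe eqxx in st.
Qed.

Lemma dual_chain (G : dgraph) (n : nat) (F : nat -> sub_dgraph G) :
  std_filtration n F (whole G) -> chain n (fun j => dual_sub (F j)).
Proof.
move=> stF; have [wfF _ _ _] := stF; split=> j jn.
  by apply: dual_wf => [|f]; [apply: wfF | apply: (std_late_edge stF jn); rewrite inE].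
apply: dual_adjoins (std_adjoins stF jn); first exact/wfF/ltnW.
by move=> f; apply: (std_late_edge stF jn); rewrite inE.
Qed.

Lemma dual_std_filtration (G : dgraph) (n : nat) (F : nat -> sub_dgraph G) :
  std_filtration n F (whole G) ->
  std_filtration n (fun i => dual_sub (F (n - i)%N)) (dual_sub (F 0%N)).
Proof.
move=> stF; have [wfH adH] := dual_chain stF.
have [_ _ _ FnE] := stF.
split=> [j _ | | j jn |]; last by rewrite subnn.
- exact/wfH/leq_subr.
- by rewrite subn0 FnE; split; apply: setDv.
by have := adH (n - j.+1)%N; rewrite subnSK //; apply; apply: leq_subr.
Qed.

Lemma adjoins_wf (X : multigraph) (K K' : sub_dgraph X) :
  sub_dgraph_wf K -> adjoins K K' -> sub_dgraph_wf K'.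
Proof.
move=> [iK eK] [e ad].
have [vK' iK' eK' sK' tK'] : [/\ verts K \subset verts K',
    inter K' \subset verts K', edges K' = e |: (erev e |: edges K),
    src e \in verts K' & tgt e \in verts K'].
  case: ad => [[[_ vK'] [_ _ eK'] [tK iK'] _ _] | [vK' iK' [_ _ eK'] sb tb]].
    rewrite vK' iK' subsetU1 setU11 in_setU1 bdry_verts ?orbT //.
    by rewrite subUset sub1set in_setU1 bdry_verts ?orbT // subsetU // iK orbT.
  by rewrite !bdry_verts // iK' vK' iK.
split=> // f; rewrite eK' !inE => /or3P[/eqP-> | /eqP-> | fK].
- by rewrite eqxx orbT.
- by rewrite erevK eqxx src_erev.
- by have /andP[-> /(subsetP vK')->] := eK f fK; rewrite !orbT.
Qed.

(** A standard form filtration can be continued by one more adjunction. *)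
Lemma std_snoc (X : multigraph) (n : nat) (F : nat -> sub_dgraph X)
    (K K' : sub_dgraph X) :
  std_filtration n F K -> adjoins K K' ->
  exists n' F', std_filtration n' F' K'.
Proof.
move=> [wfF isoF adF FnE] ad.
exists n.+1, (fun j => if (j <= n)%N then F j else K'); split=> [j _ | // | j |].
- case: ifP => [/wfF // | _]; apply: adjoins_wf ad.
  by rewrite -FnE; apply: wfF.
- rewrite ltnS => jn; rewrite jn; case: ifP => [/adF // | nj].
  by have -> : j = n; [apply/eqP; rewrite eqn_leq jn leqNgt nj | rewrite FnE].
- by rewrite ltnn.
Qed.

(** A layerable graph has a filtration in which all isolated boundary vertices
    come first: an isolated vertex adjoined late is added to every stage. *)
Lemma layerable_std_filtration (X : multigraph) (K : sub_dgraph X) :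
  layerable_sub K -> exists n F, std_filtration n F K.
Proof.
elim=> {K} [|x K K' _ [n [F stF]] | e K K' _ [n [F stF]] sp
           | e K K' _ [n [F stF]] ed].
- exists 0%N, (fun _ => empty_sub X); split=> // j _.
  by split=> [|e]; rewrite ?sub0set ?inE.
- case=> xK vK' iK' eK' _.
  have [wfF [i0 e0] adF FnE] := stF.
  pose F' j := SubDGraph (x |: verts (F j)) (inter (F j)) (edges (F j)).
  have xF j : (j <= n)%N -> x \notin verts (F j).
    move=> jn; apply: contra xK; exact: (subsetP (std_verts stF jn)).
  have bF j y : y \in bdry (F j) -> y \in bdry (F' j).
    by rewrite !mem_bdry in_setU1 => /andP[-> ->]; rewrite orbT.
  exists n, F'; split=> [j jn | | j jn |].
  + have [iF eF] := wfF j jn; split=> [|e /eF /andP[/= -> sF]].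
      exact: subset_trans iF (subsetU1 _ _).
    by rewrite in_setU1 sF orbT.
  + by split.
  + have [e [[[sF vF] eF [tF iF] sF' uF] | [vF iF eF sF tF]]] := adF j jn.
      exists e; left; split=> //=.
      * split; last by rewrite vF setUCA.
        rewrite in_setU1 negb_or sF andbT.
        by apply: contraNneq (xF _ jn) => <-; rewrite vF setU11.
      * by split=> //; apply: bF.
      * exact: bF.
    by exists e; right; split; rewrite /= ?vF //; apply: bF.
  + by rewrite /F' FnE -vK' -iK' -eK'; case: (K').
- by apply: std_snoc stF _; exists e; left.
- by apply: std_snoc stF _; exists e; right.
Qed.

(** * Existence of labellings and transformations *)

(** Dependent choice along a finite sequence, from its last index downwards. *)
Lemma backward_rec (A : Type) (n : nat) (P : nat -> A -> Prop)
    (Q : nat -> A -> A -> Prop) (a : A) :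
  P n a ->
  (forall j b, (j < n)%N -> P j.+1 b -> exists2 c, P j c & Q j b c) ->
  exists f : nat -> A, [/\ f n = a, forall j, (j <= n)%N -> P j (f j) &
    forall j, (j < n)%N -> Q j (f j.+1) (f j)].
Proof.
elim: n a => [|n IHn] a Pa step.
  by exists (fun=> a); split=> // j; rewrite leqn0 => /eqP->.
have [b Pb Qab] := step n a (leqnn _) Pa.
have [|f [fn Pf Qf]] := IHn b Pb; first by move=> j c /leqW; apply: step.
have lt_neq j : (j <= n)%N -> (j == n.+1) = false by move=> jn; rewrite ltn_eqF.
exists (fun j => if j == n.+1 then a else f j); split=> [|j|j].
- by rewrite eqxx.
- by rewrite leq_eqVlt; case: eqP => [-> // | _] /= /Pf.
rewrite ltnS => jn; rewrite (lt_neq j) // eqSS.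
case: eqP => [-> | /eqP nj]; first by rewrite fn.
by apply: Qf; rewrite ltn_neqAle nj.
Qed.

(** An enumeration of [A] followed by [B]. *)
Lemma enum_labelling (T : finType) (A B : {set T}) (s m : nat) :
  [disjoint A & B] -> s = #|A| -> m = (#|A| + #|B|)%N ->
  exists l : 'I_m -> T, [/\ injective l, [set l i | i : 'I_m] = A :|: B &
    [set l i | i : 'I_m & (i < s)%N] = A].
Proof.
move=> dAB sA mAB.
have sz : size (enum A ++ enum B) == m by rewrite size_cat -!cardE mAB.
pose t := Tuple sz.
have nth_t x0 (i : 'I_m) : tnth t i = nth x0 (enum A ++ enum B) i.
  by rewrite (tnth_nth x0).
exists (tnth t); split.
- apply/tuple_uniqP; rewrite /= cat_uniq !enum_uniq andbT /=.
  apply/hasPn=> x; rewrite !mem_enum => xB.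
  by apply: contraTN xB => xA; rewrite (disjointFr dAB).
- apply/setP=> x; rewrite inE -(mem_enum A) -(mem_enum B) -mem_cat.
  apply/imsetP/idP=> [[i _ ->] | xt]; first exact: mem_tnth.
  by have /tnthP[i ->] : x \in t := xt; exists i.
apply/setP=> x; apply/imsetP/idP=> [[i] | xA].
  rewrite inE => si ->; rewrite (nth_t x) nth_cat -cardE -sA si.
  by rewrite -mem_enum mem_nth // -cardE -sA.
have xm : (index x (enum A) < s)%N by rewrite sA cardE index_mem mem_enum.
have xm' : (index x (enum A) < m)%N.
  by rewrite mAB (leq_trans xm) // sA leq_addr.
exists (Ordinal xm'); rewrite ?inE // (nth_t x) nth_cat /= -cardE -sA xm.
by rewrite nth_index // mem_enum.
Qed.

Lemma adjoin_spike_edge (X : multigraph) (K K' : sub_dgraph X) (e : edge X) :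
  adjoin_spike e K K' -> forall f, ~ adjoin_edge f K K'.
Proof.
move=> [[sK vK'] _ _ _ _] f [vKE _ _ _ _].
by rewrite -vKE vK' setU11 in sK.
Qed.

Lemma adjoin_spike_inj (X : multigraph) (K K' : sub_dgraph X) (e f : edge X) :
  adjoin_spike e K K' -> adjoin_spike f K K' -> f = e.
Proof.
move=> [[_ vK'] _ _ _ uniq_e] [[fK vK'f] [_ _ eK'f] _ _ _].
apply: uniq_e; first by rewrite eK'f setU11.
have : src f \in verts K' by rewrite vK'f setU11.
by rewrite vK' in_setU1 (negPf fK) orbF => /eqP.
Qed.

(** For a spike, the new vertex takes over the label of the inner end. *)
Lemma labelling_step (X : multigraph) (m : nat) (K K' : sub_dgraph X)
    (l : 'I_m -> X) :
  sub_dgraph_wf K -> adjoins K K' -> is_labelling K l ->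
  exists2 l', is_labelling K' l' & consistent K K' l l'.
Proof.
move=> wfK [e [sp | ed]] labl; last first.
  exists l; last by split=> [f sp|//]; case: (adjoin_spike_edge sp ed).
  case: labl => inj_l defK; split=> //; rewrite defK.
  by case: ed; rewrite /bdry => -> ->.
have st := spike_src_neq_tgt sp.
case: (sp) => [[sK vK'] _ [tK iK'] sK' _].
have ls i : l i != src e.
  by apply: contraNneq sK => <-; apply/bdry_verts/is_labelling_bdry.
have [inj_l defK] := labl.
pose l' i := if l i == tgt e then src e else l i.
have bdryK' x : (x \in bdry K') = (x == src e) || (x != tgt e) && (x \in bdry K).
  rewrite !mem_bdry iK' vK' !inE negb_or.
  have [-> | _] := eqVneq x (src e); last by rewrite andbA.
  by rewrite st /= andbT; apply: contra sK; apply/subsetP; case: wfK.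
have [k _ lk] : exists2 k, k \in 'I_m & tgt e = l k.
  by apply/imsetP; rewrite defK.
exists l'.
  split=> [i j | ].
    rewrite /l'; case: eqP => [li | _]; case: eqP => [lj | _].
    - by move=> _; apply: inj_l; rewrite li.
    - by move=> /esym/eqP; rewrite (negPf (ls j)).
    - by move=> /eqP; rewrite (negPf (ls i)).
    - exact: inj_l.
  apply/setP=> x; rewrite bdryK'; apply/imsetP/idP=> [[i _ ->] | ].
    rewrite /l'; case: (l i =P tgt e) => [_ | /eqP ->]; first by rewrite eqxx.
    by rewrite is_labelling_bdry ?orbT.
  case/predU1P=> [-> | /andP[xt]].
    by exists k; rewrite // /l' -lk eqxx.
  rewrite -defK => /imsetP[i _ xi]; exists i => //.
  by rewrite /l' -xi (negPf xt).
split=> [f spf | f edf]; last by case: (adjoin_spike_edge sp edf).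
rewrite (adjoin_spike_inj sp spf); split.
  by exists k; rewrite /l' -lk eqxx.
move=> i i' _; rewrite /l'; case: ifP => [_ /eqP | _ /inj_l //].
by rewrite (negPf (ls i)).
Qed.

Lemma transform_step (R : comPzRingType) (X : multigraph) (L : laplacian R X)
    (m : nat) (K K' : sub_dgraph X) (l l' : 'I_m -> X) :
  is_network L -> adjoins K K' -> is_labelling K l -> consistent K K' l l' ->
  exists T : 'M[R]_(m + m), bdry_transform L K K' l l' T.
Proof.
move=> hL [e [sp | ed]] [_ defK] [cons_sp _].
  have [[k [lk l'k]] _] := cons_sp e sp; have [v wv] := hL e.
  by eexists; apply: bdry_transform_spike sp lk l'k wv.
have [vK' iK' _ sb tb] := ed; rewrite /bdry vK' iK' -/(bdry K) -defK in sb tb.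
case/imsetP: sb => p _ /esym lp; case/imsetP: tb => q _ /esym lq.
by eexists; apply: bdry_transform_edge ed lp lq.
Qed.

(** * The isomorphism *)

Lemma lmod_iso_submod (R : comPzRingType) (V W : lmodType R) (P : submodule V)
    (Q : submodule W) (g : {linear V -> W}) :
  (forall u, u \in submod_pred P -> g u \in submod_pred Q) ->
  (forall u, u \in submod_pred P -> g u = 0 -> u = 0) ->
  (forall v, v \in submod_pred Q -> exists2 u, u \in submod_pred P & g u = v) ->
  lmod_iso (submod P) (submod Q).
Proof.
move=> gP inj_g surj_g.
pose f (x : submod P) : submod Q := Submod (gP (val x) (valP x)).
have lin_f : linear f.
  by move=> a x y; apply: val_inj; rewrite /= !linearP.
pose lf := GRing.isLinear.Build R (submod P) (submod Q) *:%R f lin_f.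
pose F : {linear submod P -> submod Q} := HB.pack f lf.
exists F => /=.
have inj_f : injective f.
  move=> x y /(congr1 val) /= fxy; apply/val_inj/eqP; rewrite -subr_eq0 -raddfB.
  by apply/eqP/inj_g; [apply: valP | rewrite !raddfB /= fxy subrr].
have surj_f y : exists x, f x == y.
  have [u uP gu] := surj_g (val y) (valP y).
  by exists (Submod uP); rewrite -val_eqE /= gu.
exists (fun y => xchoose (surj_f y)) => [x | y]; last exact/eqP/(xchooseP (surj_f y)).
by apply: inj_f; apply/eqP; apply: xchooseP (surj_f (f x)).
Qed.

(** Precomposition with [h]; it restricts a function to labelled vertices. *)
Definition reindex_ffun (I J : finType) (M : Type) (h : J -> I)
    (u : {ffun I -> M}) : {ffun J -> M} := [ffun j => u (h j)].

Lemma reindex_ffun_linear (R : comPzRingType) (I J : finType)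
    (M : lmodType R) (h : J -> I) : linear (@reindex_ffun I J M h).
Proof. by move=> a u v; apply/ffunP=> j; rewrite !ffunE. Qed.

HB.instance Definition _ (R : comPzRingType) (I J : finType)
    (M : lmodType R) (h : J -> I) :=
  GRing.isLinear.Build R {ffun I -> M} {ffun J -> M} *:%R
    (@reindex_ffun I J M h) (@reindex_ffun_linear R I J M h).

Lemma lap_sub_lap (R : comPzRingType) (X : multigraph) (L : laplacian R X)
    (M : lmodType R) (K : sub_dgraph X) (u : {ffun X -> M}) (x : X) :
  edges K = setT -> lap L u x = sub_lap L K u x.
Proof.
move=> eK; rewrite ffunE /sub_lap; congr (_ + _).
by apply: eq_bigl => f; rewrite eK inE.
Qed.

Lemma sub_lap_no_edge (R : comPzRingType) (X : multigraph) (L : laplacian R X)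
    (M : lmodType R) (K : sub_dgraph X) (u : {ffun X -> M}) (x : X) :
  edges K = set0 -> sub_lap L K u x = diag L x *: u x.
Proof.
by move=> eK; rewrite /sub_lap big1 ?addr0 // => f; rewrite eK inE.
Qed.

(** Restriction to [S], that is to the first [s] labels, is an isomorphism from
    [U0] onto the kernel. *)
Lemma U0_iso_layer_matrix (R : comPzRingType) (G : dgraph) (L : laplacian R G)
    (S : {set G}) (n s m : nat) (H : nat -> sub_dgraph G)
    (l : nat -> 'I_m -> G) (T : nat -> 'M[R]_(m + m)) (M : lmodType R) :
  is_network L -> S \subset interior G -> (s <= m)%N -> chain n H ->
  verts (H n) = S :|: boundary G -> inter (H n) = set0 ->
  edges (H n) = set0 -> verts (H 0%N) = setT -> edges (H 0%N) = setT ->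
  good_labelling n s H S l -> good_transforms L n H l T ->
  lmod_iso (U0 L M) (mxker (layer_matrix n s T) M).
Proof.
move=> hL hS sm cH vHn iHn eHn vH0 eH0 [labl cons lS] [Tn trT].
have labn := labl n (leqnn n).
have bHn : bdry (H n) = S :|: boundary G by rewrite /bdry iHn setD0.
pose wd := widen_ord sm.
have l_lt (i : 'I_m) : (i < s)%N -> l n i \in S.
  by move=> si; rewrite -lS; apply: imset_f; rewrite inE.
have l_ge (i : 'I_m) : (s <= i)%N -> l n i \in boundary G.
  move=> si; have := is_labelling_bdry i labn; rewrite bHn inE => /orP[|//].
  rewrite -lS => /imsetP[i']; rewrite inE => si' /labn.1 ii'.
  by rewrite -ii' ltnNge si in si'.
have S_bd x : x \in boundary G -> x \notin S.
  by rewrite inE; apply: contra; apply/subsetP.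
have data_n (u : {ffun G -> M}) : {in boundary G, forall x, u x = 0} ->
    bdata L (H n) (l n) u =
    mxact (T n) (mxact (pid_mx s) (reindex_ffun (l n \o wd) u)).
  move=> u0; rewrite mxact_pid pad_add // Tn mxact_block !mxact1 mxact0 addr0.
  have -> : pad m (reindex_ffun (l n \o wd) u) = [ffun i => u (l n i)].
    apply/ffunP=> i; rewrite !ffunE; case: insubP => [j _ ji | si] /=.
      by rewrite ffunE /=; congr (u (l n _)); apply: val_inj.
    by rewrite u0 // l_ge // leqNgt.
  congr stack; apply/ffunP=> i.
  by rewrite add_ffunE mxact_diag !ffunE mxE addr0 sub_lap_no_edge.
(* On harmonic functions vanishing on the boundary of [G], the matrix yields
   the Laplacian on the boundary of [H 0]. *)
have act_A (u : {ffun G -> M}) : harmonic L (H 0%N) u ->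
    {in boundary G, forall x, u x = 0} ->
    mxact (layer_matrix n s T) (reindex_ffun (l n \o wd) u) =
    [ffun i => sub_lap L (H 0%N) u (l 0%N i)].
  move=> hu u0; have [_ b0] := chain_harmonic cH labl cons trT hu.
  rewrite /layer_matrix !mxactM big_ord_recr /= -mulmxE mxactM -data_n // -b0.
  by rewrite mxact_row01; apply/ffunP=> i; rewrite [LHS]ffunE stack_rshift.
have U0P (u : {ffun G -> M}) : reflect
    (harmonic L (H 0%N) u /\ [/\ {in boundary G, forall x, u x = 0} &
       mxact (layer_matrix n s T) (reindex_ffun (l n \o wd) u) = 0])
    (u \in U0_pred L M).
  rewrite inE; apply: (iffP andP) => [[/forallP lu /forall_inP u0] | [hu [u0 Au]]].
    have u0' : {in boundary G, forall x, u x = 0} by move=> x /u0/eqP.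
    have lu' x : sub_lap L (H 0%N) u x = 0.
      by rewrite -lap_sub_lap //; apply/eqP/lu.
    split=> [x _|]; first exact: lu'.
    split; rewrite // act_A //.
    by apply/ffunP=> i; rewrite !ffunE lu'.
  split; last by apply/forall_inP=> x /u0/eqP.
  apply/forallP=> x; rewrite (lap_sub_lap L u x eH0).
  have [/hu/eqP // | xH] := boolP (x \in inter (H 0%N)).
  have : x \in bdry (H 0%N) by rewrite mem_bdry xH vH0 inE.
  have [_ <-] := labl 0%N isT; case/imsetP=> i _ ->.
  by move: Au; rewrite act_A // => /ffunP/(_ i); rewrite !ffunE => ->.
apply: (lmod_iso_submod (g := reindex_ffun (l n \o wd))) => /=.
- by move=> u /U0P[_ [_ Au]]; rewrite inE; apply/eqP.
- move=> u /U0P[hu [u0 _]] gu0.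
  have [hH _] := chain_harmonic cH labl cons trT hu.
  have un0 : {in verts (H n), forall x, u x = 0}.
    move=> x; rewrite vHn inE => /orP[|/u0 //].
    rewrite -lS => /imsetP[i]; rewrite inE => si ->.
    move/ffunP/(_ (Ordinal si)): gu0; rewrite !ffunE /= => <-.
    by congr (u (l n _)); apply: val_inj.
  apply/ffunP=> x; rewrite ffunE.
  by apply: (chain_unique hL cH hH un0); rewrite vH0 inE.
move=> a; rewrite inE => /eqP Aa.
(* [a] on [S] and zero elsewhere, to be extended along the chain. *)
pose u0 : {ffun G -> M} :=
  [ffun x => if [pick i | l n (wd i) == x] is Some i then (a : {ffun _}) i else 0].
have hn : harmonic L (H n) u0 by move=> x; rewrite iHn inE.
have [u uE hu] := chain_extend hL cH hn.
have ubd : {in boundary G, forall x, u x = 0}.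
  move=> x xb; rewrite uE; last by rewrite vHn inE xb orbT.
  rewrite ffunE; case: pickP => // i /eqP li.
  by have := S_bd x xb; rewrite -li l_lt /=.
have gu : reindex_ffun (l n \o wd) u = a.
  apply/ffunP=> i; rewrite ffunE /= uE; last by rewrite vHn inE l_lt /=.
  rewrite ffunE; case: pickP => [j /eqP/labn.1 /(congr1 val) ji | /(_ i)].
    by congr (_ _); apply: val_inj.
  by rewrite eqxx.
by exists u => //; apply/U0P; rewrite gu.
Qed.

Theorem theorem5p23 (R : comPzRingType) (G : dgraph) (L : laplacian R G)
  (hL : is_network L) (S : {set G}) (hS : S \subset interior G)
  (hlay : layerable (to_boundary S))
  (s m : nat) (hs : s = #|S|) (hm : m = (#|S| + #|boundary G|)%N) :
  (exists A : 'M[R]_(m, s), forall M : lmodType R,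
     lmod_iso (U0 L M) (mxker A M)) /\
  (forall (n : nat) (F : nat -> sub_dgraph (to_boundary S)),
     std_filtration n F (whole (to_boundary S)) ->
     let H := fun j => dual_sub (F j) in
     [/\ std_filtration n (fun i => H (n - i)%N) (H 0%N),
         forall j, (j <= n)%N -> bdry (H j) = bdry (F j),
         exists l : nat -> 'I_m -> G, good_labelling n s H S l &
         forall l : nat -> 'I_m -> G, good_labelling n s H S l ->
           (exists T : nat -> 'M[R]_(m + m), good_transforms L n H l T) /\
           (forall T : nat -> 'M[R]_(m + m), good_transforms L n H l T ->
              forall M : lmodType R,
                lmod_iso (U0 L M) (mxker (layer_matrix n s T) M))]).
Proof.
set part2 := (X in _ /\ X).
suff p2 : part2.
  split=> //; have [n [F stF]] := layerable_std_filtration hlay.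
  have [_ _ [l gl] /(_ l gl)[[T gT] iso]] := p2 n F stF.
  by exists (layer_matrix n s T) => M; apply: iso.
move=> n F stF H.
have cH : chain n H := dual_chain stF.
have [_ [i0 e0] _ FnE] := stF.
have vHn : verts (H n) = S :|: boundary G.
  by apply/setP=> x; rewrite /H FnE /= !inE andbT negb_and negbK.
have iHn : inter (H n) = set0 by rewrite /H FnE /= setDv.
have eHn : edges (H n) = set0 by rewrite /H FnE /= setDv.
have vH0 : verts (H 0%N) = setT by rewrite /= i0 setD0.
have eH0 : edges (H 0%N) = setT by rewrite /= e0 setD0.
have [wfH adH] := cH.
split=> [| j _ | | l gl].
- exact: dual_std_filtration.
- exact: bdry_dual.
- have dSb : [disjoint S & boundary G].
    by rewrite disjoints_subset setCK.
  have [ln [inj_ln im_ln lS]] := enum_labelling dSb hs hm.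
  have labn : is_labelling (H n) ln by split=> //; rewrite im_ln /bdry iHn setD0.
  have [|l [ln' labl cons]] := backward_rec
    (P := fun j l => is_labelling (H j) l)
    (Q := fun j l l' => consistent (H j.+1) (H j) l l') labn.
    by move=> j b jn; apply: labelling_step; [apply: wfH | apply: adH].
  by exists l; split; rewrite ?ln'.
have [labl cons _] := gl; split.
  have [//||T [Tn _ trT]] := backward_rec (n := n) (P := fun _ _ => True)
    (Q := fun j _ T => bdry_transform L (H j.+1) (H j) (l j.+1) (l j) T)
    (a := block_mx 1%:M 0 (diag_mx (\row_i diag L (l n i))) 1%:M).
    move=> j _ jn _.
    have [T trT] := transform_step hL (adH j jn) (labl _ jn) (cons j jn).
    by exists T.
  by exists T.
move=> T gT M; apply: (U0_iso_layer_matrix M hL hS _ cH) gl gT => //.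
by rewrite hs hm leq_addr.
Qed.
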